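(* Let $n\ge 2$ and $r\ge1$ be integers and $p$ a positive divisor of $r$ with $\gcd(n,p,r/p)=1$. Then there exists an integer $\alpha$ with $0\le\alpha<r/p$ such that the sequence $\mathbf u=(u_{n-1},u_{n-2},\dots,u_0)$ is a perfect basis for $G(r,p,n)$, where $u_i=(\bar c_i;t_i)$ with $t_0=\mathrm{id}$, $t_i=s_is_{i-1}\cdots s_1$ for $1\le i\le n-1$ ($s_j=(j,j+1)$), $\bar c_i=(1,0,\dots,0,\alpha p-1)\in\mathbf Z_r^n$ for $0\le i\le n-2$, and $\bar c_{n-1}=(1,0,\dots,0,p-1)\in\mathbf Z_r^n$.
   Context: $G(r,n)$ is the set of pairs $((c_1,\dots,c_n);\pi)$, $c_i\in\mathbf Z_r=\mathbf Z/r\mathbf Z$, $\pi\in S_n$, with multiplication $((c_1,\dots,c_n);\pi)\cdot((c'_1,\dots,c'_n);\pi')=((c_1+c'_{\pi^{-1}(1)},\dots,c_n+c'_{\pi^{-1}(n)});\pi\pi')$, $(\pi\pi')(j)=\pi(\pi'(j))$. $G(r,p,n)$ is the subgroup of elements with $\sum_i c_i\equiv0\pmod p$. Thus $t_i$ is the permutation with $t_i(1)=i+1$, $t_i(j)=j-1$ for $2\le j\le i+1$, $t_i(j)=j$ for $j>i+1$. In $\bar c_i$ the first coordinate is $1$, the last coordinate is as shown, and all other coordinates are $0$. A sequence $(a_1,\dots,a_m)$ of elements of a finite group $G$ is a perfect basis if every $g\in G$ has a unique presentation $g=a_1^{k_1}\cdots a_m^{k_m}$ with $0\le k_i<o(a_i)$,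 where $o(a_i)$ is the order of $a_i$. *)

(* Defs.v *)
From HB Require Import structures.
From mathcomp Require Import all_boot all_order all_fingroup all_algebra.
From mathcomp Require Import zify.

Set Implicit Arguments.
Unset Strict Implicit.
Unset Printing Implicit Defensive.

Import GRing.Theory.

(* Z/rZ for every r >= 1.  The notation 'Z_r is not used because 'Z_1 denotes
   Z/2Z, whereas 'I_(r.-1.+1) is the trivial group when r = 1; its canonical
   additive group structure is addition modulo r, and inZp is reduction. *)
Notation Zmod r := 'I_(r.-1.+1).

(* G(r,n).  The coordinates 1, ..., n are numbered 0, ..., n-1. *)
Record Grn (r n : nat) : predArgType :=
  MkGrn { Gcol : {ffun 'I_n -> Zmod r}; Gperm : 'S_n }.

Section GrnGroup.

Variables r n : nat.
Implicit Types g h k : Grn r n.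

Definition Grn_pair g := (Gcol g, Gperm g).
Definition Grn_of_pair (x : {ffun 'I_n -> Zmod r} * 'S_n) : Grn r n :=
  MkGrn x.1 x.2.

Lemma Grn_pairK : cancel Grn_pair Grn_of_pair.
Proof. by case. Qed.

HB.instance Definition _ := Finite.copy (Grn r n) (can_type Grn_pairK).

(* The product of 'S_n composes from left to right, (s * t) j = t (s j), so the
   composite j |-> pi (pi' j) of pi = Gperm g and pi' = Gperm h is
   Gperm h * Gperm g. *)
Definition Grn_mul g h : Grn r n :=
  MkGrn [ffun i => (Gcol g i + Gcol h ((Gperm g)^-1%g i))%R]
        (Gperm h * Gperm g)%g.

Definition Grn_one : Grn r n := MkGrn [ffun=> 0%R] 1%g.

Definition Grn_inv g : Grn r n :=
  MkGrn [ffun i => (- Gcol g (Gperm g i))%R] (Gperm g)^-1%g.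

Lemma Grn_eqP g h : Gcol g =1 Gcol h -> Gperm g = Gperm h -> g = h.
Proof.
by case: g h => [c s] [d t] /= eq_cd ->; congr MkGrn; apply/ffunP.
Qed.

Lemma Grn_mulA : associative Grn_mul.
Proof.
move=> g h k; apply: Grn_eqP => [i|] /=; last by rewrite mulgA.
by rewrite !ffunE invMg permM addrA.
Qed.

Lemma Grn_mul1 : left_id Grn_one Grn_mul.
Proof.
move=> g; apply: Grn_eqP => [i|] /=; last by rewrite mulg1.
by rewrite !ffunE invg1 perm1 add0r.
Qed.

Lemma Grn_mulV : left_inverse Grn_one Grn_inv Grn_mul.
Proof.
move=> g; apply: Grn_eqP => [i|] /=; last by rewrite mulgV.
by rewrite !ffunE invgK addNr.
Qed.

HB.instance Definition _ :=
  Finite_isGroup.Build (Grn r n) Grn_mulA Grn_mul1 Grn_mulV.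

(* G(r,p,n).  The sum is that of the representatives in {0, ..., r-1}; its
   class mod p is that of the sum in Z/rZ when p divides r. *)
Definition Grpn (p : nat) : {set Grn r n} :=
  [set g : Grn r n | p %| \sum_(i < n) (Gcol g i : nat)].

Lemma Grpn_group_set (p : nat) : 0 < r -> p %| r -> group_set (Grpn p).
Proof.
move=> r_gt0 p_r; apply/group_setP; split.
  by rewrite inE big1 // => i _; rewrite ffunE.
move=> g h; rewrite !inE => pg ph; rewrite /dvdn.
have -> : \sum_(i < n) (Gcol (g * h)%g i : nat)
   = \sum_(i < n) Gcol g i + \sum_(i < n) Gcol h ((Gperm g)^-1%g i) %[mod p].
  rewrite -big_split /=.
  elim/big_rec2: _ => [//|i x y _ e].
  rewrite ffunE /= -modnDm e modn_dvdm ?modnDm // prednK //.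
have <- : \sum_(i < n) (Gcol h i : nat)
        = \sum_(i < n) Gcol h ((Gperm g)^-1%g i).
  exact: (reindex_inj (@perm_inj _ (Gperm g)^-1%g)).
exact: dvdn_add.
Qed.

End GrnGroup.

Section Generators.

Variables (r n : nat).

(* With the points numbered from 0, (j, j+1) exchanges j-1 and j;
   only used for 0 < j. *)
Definition sgen (j : 'I_n) : 'S_n := tperm (ord_pred j) j.

(* s_i s_(i-1) ... s_1 applies s_1 first, so s_1 is the leftmost factor for
   the left-to-right product of 'S_n. *)
Definition tgen (i : nat) : 'S_n := (\prod_(j < n | 0 < j <= i) sgen j)%g.

Lemma sgenE (j x : 'I_n) : 0 < j ->
  sgen j x = (if x == j.-1 :> nat then j : nat
              else if x == j :> nat then j.-1 else x) :> nat.
Proof.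
move=> j0; have n0 : 0 < n by apply: leq_ltn_trans (ltn_ord j).
have pj : ord_pred j = j.-1 :> nat.
  rewrite /= -[in (j + n).-1](prednK j0) addSn /= modnDr modn_small //.
  by rewrite prednK // ltnW.
rewrite /sgen; case: tpermP => [->|->|/eqP nx /eqP ny].
- by rewrite pj eqxx.
- by rewrite pj eqxx; case: eqP => // <-.
- by rewrite -pj -!val_eqE /= in nx ny *; rewrite (negPf nx) (negPf ny).
Qed.

Lemma tgenE (i : nat) (j : 'I_n) : i < n ->
  tgen i j = (if j == 0 :> nat then i else if j <= i then j.-1 else j) :> nat.
Proof.
elim: i => [|i IH] lin.
  rewrite /tgen big_pred0 ?perm1 => [|k]; last by rewrite lt0n leqn0; case: eqP.
  by case: (j : nat).
have -> : tgen i.+1 = (tgen i * sgen (Ordinal lin))%g.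
  pose F (k : nat) := if insub k is Some k' then sgen k' else 1%g.
  have tgenF m : m < n -> tgen m = (\prod_(k < m.+1 | 0 < k) F k)%g.
    move=> lm; rewrite (big_ord_widen_cond _ (fun k => 0 < k) F lm).
    by apply: eq_bigr => k _; rewrite /F valK.
  rewrite !tgenF ?(ltnW lin) // big_mkcond big_ord_recr -big_mkcond /=.
  by rewrite /F insubT.
rewrite permM sgenE //= IH ?(ltnW lin) //.
case: j {IH} => [[|j] lj] /=; first by rewrite eqxx.
by case: (ltngtP j i) => lji; repeat case: ifP; lia.
Qed.

(* (1, 0, ..., 0, x), for n >= 2. *)
Definition cbar (x : Zmod r) : {ffun 'I_n -> Zmod r} :=
  [ffun j : 'I_n => if j == 0 :> nat then inZp 1
                    else if j == n.-1 :> nat then x else 0%R].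

Definition ugen (p alpha i : nat) : Grn r n :=
  MkGrn (cbar (if i == n.-1 then inZp p - inZp 1
               else inZp (alpha * p)%N - inZp 1)%R)
        (tgen i).

(* (u_(n-1), u_(n-2), ..., u_0) *)
Definition useq (p alpha : nat) : n.-tuple (Grn r n) :=
  [tuple ugen p alpha (n.-1 - i) | i < n].

End Generators.

Definition perfect_basis (gT : finGroupType) (G : {set gT}) (m : nat)
    (a : m.-tuple gT) : Prop :=
  (forall i : 'I_m, tnth a i \in G) /\
  (forall g : gT, g \in G ->
    exists! k : {ffun 'I_m -> nat},
      (forall i : 'I_m, k i < #[tnth a i]%g) /\
      g = (\prod_(i < m) tnth a i ^+ k i)%g).

(* Main.v *)
(** Write [n = m + 1] and [u_i] for the generators. For [l <= m] let [T_l] be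
    the set of elements that fix the coordinates from [l] on, are uncoloured at
    the coordinates [l <= j < m], and whose last colour is [alpha p - 1] times
    the sum of the others. These are subgroups with [T_0 = 1], and
    [T_(i+1) = <u_i> T_i] with [<u_i>] and [T_i] meeting trivially: [u_i]
    permutes cyclically the [(i+1) r] pairs (coordinate [<= i], colour). On top,
    [G(r,p,n) = <u_m> T_m], again with trivial intersection: [u_m^n] is the
    constant colouring [p], and landing in [T_m] is a linear congruence with
    coefficient [n - m alpha p] modulo [r/p], which is uniquely solvable once
    this coefficient is prime to [r/p]. Such a chain of factorizations is a
    perfect basis, without any need for the orders of the [u_i]. *)

Require Import Defs.
From mathcomp Require Import all_boot all_order all_fingroup all_algebra.
From mathcomp Require Import cyclic zify ring.

Set Implicit Arguments.
Unset Strict Implicit.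
Unset Printing Implicit Defensive.

Import GRing.Theory.

(** * Perfect bases from chains of factorizations *)

Section Chain.

Variable gT : finGroupType.
Implicit Types (a : nat -> gT) (H : nat -> {group gT}) (k : nat -> nat).

(** Exponents are indexed by generator, not by position, so that splitting off the leftmost factor
    leaves the same [k]. *)
Definition desc_prod a n k : gT :=
  (\prod_(i < n) a (n.-1 - i)%N ^+ k (n.-1 - i)%N)%g.

Lemma desc_prodS a n k :
  desc_prod a n.+1 k = (a n ^+ k n * desc_prod a n k)%g.
Proof.
rewrite /desc_prod big_ord_recl /= subn0; congr (_ * _)%g.
apply: eq_bigr => i _; rewrite /bump /= add1n.
by have -> : (n - i.+1 = n.-1 - i)%N by lia.
Qed.

Lemma eq_desc_prod a n k k' :
  (forall i, i < n -> k i = k' i) -> desc_prod a n k = desc_prod a n k'.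
Proof.
elim: n => [|n IHn] eq_k; first by rewrite /desc_prod !big_ord0.
by rewrite !desc_prodS eq_k // IHn // => i lt_in; apply: eq_k; apply: ltnW.
Qed.

Variables (a : nat -> gT) (H : nat -> {group gT}) (n : nat).
Hypothesis H0 : H 0 :=: 1%g.
Hypothesis H_mul : forall i, i < n -> H i.+1 :=: (<[a i]> * H i)%g.
Hypothesis H_TI : forall i, i < n -> (<[a i]> :&: H i)%g = 1%g.

Lemma mem_chain i j : i < j <= n -> a i \in H j.
Proof.
elim: j => // j IHj; rewrite ltnS => /andP[le_ij lt_jn].
rewrite H_mul //; move: le_ij; rewrite leq_eqVlt => /predU1P[->|lt_ij].
  by rewrite (subsetP (mulG_subl _ _)) ?cycle_id.
by rewrite (subsetP (mulG_subr _ _)) // IHj // lt_ij ltnW.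
Qed.

Lemma desc_prod_chain j k : j <= n -> desc_prod a j k \in H j.
Proof.
elim: j => [|j IHj] lt_jn; first by rewrite /desc_prod big_ord0.
by rewrite desc_prodS H_mul // mem_mulg ?mem_cycle // IHj // ltnW.
Qed.

Lemma desc_prod_exists j g : j <= n -> g \in H j ->
  exists2 k, forall i, k i < #[a i]%g & g = desc_prod a j k.
Proof.
elim: j g => [|j IHj] g lt_jn.
  (* The bound on [k] is asked at every index, also beyond [j]; 0 meets it because orders are
     positive. *)
  rewrite H0 => /set1P->; exists (fun=> 0) => //.
  by rewrite /desc_prod big_ord0.
rewrite H_mul // => /mulsgP[x h /cyclePmin[e lt_e ->] Hh ->].
have [k lt_k ->] := IHj h (ltnW lt_jn) Hh.
exists (fun i => if i == j then e else k i) => [i|]; first by case: eqP => [->|].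
rewrite desc_prodS eqxx; congr (_ * _)%g; apply: eq_desc_prod => i lt_ij.
by rewrite ltn_eqF.
Qed.

(** The quotient of the two leading powers lies both in [<[a j]>] and in [H j], hence is 1. The
    leading exponents then agree modulo the order, so are equal, and the rest follows by
    cancellation and induction. *)
Lemma desc_prod_inj j k k' : j <= n ->
  (forall i, i < j -> k i < #[a i]%g) -> (forall i, i < j -> k' i < #[a i]%g) ->
  desc_prod a j k = desc_prod a j k' -> forall i, i < j -> k i = k' i.
Proof.
elim: j => // j IHj lt_jn lt_k lt_k'; rewrite !desc_prodS => eq_k.
set h := desc_prod a j k in eq_k; set h' := desc_prod a j k' in eq_k.
have [Hh Hh'] : h \in H j /\ h' \in H j by split; apply/desc_prod_chain/ltnW.
have eq_quot : ((a j ^+ k' j)^-1 * a j ^+ k j = h' * h^-1)%g.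
  by apply: (mulIg h); rewrite mulgKV -mulgA eq_k mulKg.
have : ((a j ^+ k' j)^-1 * a j ^+ k j)%g \in (<[a j]> :&: H j)%g.
  by rewrite inE {2}eq_quot !groupM ?groupV ?mem_cycle.
rewrite H_TI // => /set1P eq1.
have eq_kj : k j = k' j.
  have /eqP : (a j ^+ k j = a j ^+ k' j)%g.
    by rewrite -[RHS]mulg1 -eq1 mulKVg.
  by rewrite eq_expg_mod_order !modn_small ?lt_k ?lt_k' // => /eqP.
have eq_h : h = h' by apply: (mulgI (a j ^+ k j)%g); rewrite eq_k eq_kj.
move=> i; rewrite ltnS leq_eqVlt => /predU1P[-> //|].
by apply: IHj => //; [exact: ltnW | move=> ? /ltnW; apply: lt_k
  | move=> ? /ltnW; apply: lt_k'].
Qed.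

Lemma perfect_basis_chain :
  perfect_basis (H n) [tuple a (n.-1 - i)%N | i < n].
Proof.
split=> [i|g Hg]; first by rewrite tnth_mktuple mem_chain //; have := ltn_ord i; lia.
have prodE (k : {ffun 'I_n -> nat}) (k' : nat -> nat) :
    (forall i : 'I_n, k i = k' (n.-1 - i)%N) ->
    (\prod_(i < n) tnth [tuple a (n.-1 - i)%N | i < n] i ^+ k i)%g =
    desc_prod a n k'.
  by move=> kE; apply: eq_bigr => i _; rewrite tnth_mktuple kE.
have [k lt_k ->] := desc_prod_exists (leqnn n) Hg.
exists [ffun i : 'I_n => k (n.-1 - i)%N]; split.
  split=> [i|]; first by rewrite tnth_mktuple ffunE.
  by rewrite (prodE _ k) // => i; rewrite ffunE.
move=> f [lt_f eq_f]; apply/ffunP => i; rewrite ffunE.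
have n_gt0 : 0 < n by have := ltn_ord i; lia.
(* The position of generator [j] in the tuple; the default [i] is never reached. *)
pose rev_idx (j : nat) : 'I_n := insubd i (n.-1 - j)%N.
have rev_idxE j : j < n -> rev_idx j = (n.-1 - j)%N :> nat.
  by move=> lt_jn; rewrite val_insubd; case: ifP => //; lia.
have rev_idxK (j : 'I_n) : rev_idx (n.-1 - j)%N = j.
  by apply: val_inj; rewrite /= rev_idxE; have := ltn_ord j; lia.
rewrite -[f i](congr1 f (rev_idxK i)).
apply: (desc_prod_inj (k' := fun j => f (rev_idx j)) (leqnn n)).
- by move=> *; apply: lt_k.
- move=> j lt_jn; have := lt_f (rev_idx j); rewrite tnth_mktuple rev_idxE //.
  by have -> : (n.-1 - (n.-1 - j) = j)%N by lia.
- by rewrite eq_f; apply: prodE => j; rewrite rev_idxK.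
- by have := ltn_ord i; lia.
Qed.

End Chain.

(** * Choice of alpha *)

Lemma exists_coprime_shift m p q : 0 < q -> gcdn m.+1 (gcdn p q) = 1 ->
  exists2 alpha, alpha < q & coprimez (m.+1%:Z - (m * (alpha * p))%:Z)%R q%:Z.
Proof.
(* A prime divisor of [q] divides exactly one of [m.+1] and [alpha]; if it
   divides [m.+1] it divides neither [m] nor, by hypothesis, [p]. *)
move=> q_gt0 gcd1; exists (q`_(\pi(m.+1)^') %% q); first by rewrite ltn_pmod.
(* [A] is the part of [q] composed of the primes not dividing [m.+1]. Reducing it modulo [q]
   preserves divisibility by the prime divisors of [q]. *)
set A := q`__; set alpha := A %% q.
set N := (_ - _)%R; rewrite coprimezE; apply/negPn/negP => not_coprime.
have gcd_gt1 : 1 < gcdn `|N| q.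
  by move: not_coprime; rewrite /coprime /= ltn_neqAle eq_sym gcdn_gt0 q_gt0 orbT => ->.
pose l := pdiv (gcdn `|N| q).
have l_pr : prime l by exact: pdiv_prime.
have [l_N l_q] : l %| `|N| /\ l %| q.
  by move: (pdiv_dvd (gcdn `|N| q)); rewrite dvdn_gcd => /andP.
have l_alpha : (l %| alpha) = (l %| A) by rewrite /alpha /dvdn modn_dvdm.
(* As [l] divides [N], the two terms of [N] are congruent modulo [l]. *)
have l_n : (l %| m.+1) = (l %| m * (alpha * p)).
  move: l_N; rewrite -[l]/`|Posz l|%N -dvdzE -eqz_mod_dvd !modz_nat eqz_nat /dvdn.
  by move/eqP->.
have [ln | not_ln] := boolP (l %| m.+1).
  have : l %| m * (alpha * p) by rewrite -l_n.
  rewrite !Euclid_dvdM // => /or3P[lm | | lp].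
  - have : l %| 1 by rewrite -(dvdn_addr 1 lm) addn1.
    by rewrite dvdn1; case: eqP l_pr => // ->.
  - rewrite l_alpha => lA.
    have : l \in \pi(A) by rewrite mem_primes l_pr part_gt0.
    move/(pnatPpi (part_pnat _ _)).
    by rewrite !inE /= mem_primes l_pr ln.
  - have : l %| gcdn m.+1 (gcdn p q) by rewrite !dvdn_gcd ln lp.
    by rewrite gcd1 dvdn1; case: eqP l_pr => // ->.
have : l \in \pi(A).
  by rewrite pi_of_part // !inE !mem_primes l_pr q_gt0 l_q (negPf not_ln).
rewrite mem_primes => /and3P[_ _ lA].
by case/negP: not_ln; rewrite l_n !Euclid_dvdM // l_alpha lA orbT.
Qed.

(** * Residues as integer multiples of 1 *)

Section Zmod.

Variable r : nat.

Definition Zmod1 : Zmod r := inZp 1.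

Lemma inZp_Zmod1 k : inZp k = (Zmod1 *+ k)%R.
Proof.
elim: k => [|k IHk]; first by apply: val_inj; rewrite /= mod0n.
by rewrite mulrS -IHk; apply: val_inj; rewrite /= modnDm.
Qed.

Lemma Zmod1_gen (x : Zmod r) : x = (Zmod1 *~ (x : nat))%R.
Proof. by rewrite -pmulrn -inZp_Zmod1 valZpK. Qed.

(** Turns linear congruences between colours into divisibility in the integers, where coefficients
    may be negative. *)
Lemma Zmod1_intmul_eq0 (z : int) : 0 < r ->
  (Zmod1 *~ z == 0)%R = (Posz r %| z)%Z.
Proof.
move=> r_gt0.
have nat_eq0 k : (Zmod1 *+ k == 0)%R = (r %| k).
  by rewrite -inZp_Zmod1 -val_eqE /= prednK.
rewrite dvdzE; case: z => k; first by rewrite -pmulrn nat_eq0.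
by rewrite NegzE mulrNz oppr_eq0 -pmulrn nat_eq0 abszN.
Qed.

End Zmod.

(** * Colours of products and powers *)

Section ColoredPermutations.

Variables r n : nat.
Implicit Types (g h : Grn r n) (x y : 'I_n).

Lemma GpermM g h x : Gperm (g * h)%g x = Gperm g (Gperm h x).
Proof. by rewrite permM. Qed.

Lemma Gperm1 x : Gperm (1 : Grn r n)%g x = x.
Proof. by rewrite perm1. Qed.

Lemma Gcol1 x : Gcol (1 : Grn r n)%g x = 0%R.
Proof. by rewrite ffunE. Qed.

(** Evaluation at the image of [x] avoids the inverse permutation. *)
Lemma GcolM g h x :
  Gcol (g * h)%g (Gperm g x) = (Gcol g (Gperm g x) + Gcol h x)%R.
Proof. by rewrite ffunE permK. Qed.

Lemma GcolM_fix g h x : Gperm g x = x ->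
  Gcol (g * h)%g x = (Gcol g x + Gcol h x)%R.
Proof. by move=> gx; rewrite -{1}gx GcolM gx. Qed.

Definition csum g : Zmod r := (\sum_(i < n) Gcol g i)%R.

Lemma csum1 : csum 1%g = 0%R.
Proof. by apply: big1 => i _; rewrite Gcol1. Qed.

Lemma csumM g h : csum (g * h)%g = (csum g + csum h)%R.
Proof.
rewrite /csum (reindex_inj (@perm_inj _ (Gperm g))).
rewrite [X in (X + _)%R](reindex_inj (@perm_inj _ (Gperm g))) -big_split.
by apply: eq_bigr => i _; rewrite GcolM.
Qed.

Lemma csumX g k : csum (g ^+ k)%g = (csum g *+ k)%R.
Proof.
by elim: k => [|k IHk]; rewrite ?csum1 // expgS csumM IHk mulrS.
Qed.

Lemma GpermX_fix g x k : Gperm g x = x -> Gperm (g ^+ k)%g x = x.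
Proof.
by move=> gx; elim: k => [|k IHk]; rewrite ?Gperm1 // expgS GpermM IHk.
Qed.

Lemma GcolX_fix g x k : Gperm g x = x -> Gcol (g ^+ k)%g x = (Gcol g x *+ k)%R.
Proof.
move=> gx; elim: k => [|k IHk]; first by rewrite Gcol1.
by rewrite expgS GcolM_fix // IHk mulrS.
Qed.

(** The colours of [g] accumulate along the orbit of [x]. *)
Lemma GcolX g x k : Gcol (g ^+ k)%g (Gperm (g ^+ k)%g x) =
  (\sum_(s < k) Gcol g (Gperm (g ^+ s.+1)%g x))%R.
Proof.
elim: k => [|k IHk]; first by rewrite big_ord0 Gcol1.
by rewrite big_ord_recr /= -IHk expgS GpermM GcolM addrC.
Qed.

Lemma commute_Gperm_fix g h x : commute g h -> Gperm g x = x ->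
  Gperm g (Gperm h x) = Gperm h x.
Proof. by move=> gh gx; rewrite -GpermM gh GpermM gx. Qed.

(** Expand the colour of [g * h = h * g] at [Gperm h x] in both ways and cancel the contribution of
    [h]. *)
Lemma commute_Gcol_fix g h x : commute g h -> Gperm g x = x ->
  Gcol g (Gperm h x) = Gcol g x.
Proof.
move=> gh gx; have := GcolM h g x; rewrite -gh GcolM_fix.
  by rewrite addrC => /addrI.
exact: commute_Gperm_fix.
Qed.

(** As [p] divides [r], the condition on representatives depends only on the class [csum g], which
    is additive in [g]. *)
Lemma in_Grpn p g : 0 < r -> p %| r ->
  reflect (exists s, csum g = Zmod1 r *+ (p * s))%R (g \in Grpn r n p).
Proof.
move=> r_gt0 p_r; rewrite inE.
have sumE : csum g = (Zmod1 r *+ \sum_(i < n) (Gcol g i : nat))%R.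
  by rewrite -sumrMnr; apply: eq_bigr => i _; rewrite -inZp_Zmod1 valZpK.
move: (\sum_(i < n) _)%N sumE => t sumE.
apply: (iffP dvdnP) => [[s sE]|[s]].
  by exists s; rewrite sumE sE mulnC.
rewrite sumE -!inZp_Zmod1 => /(congr1 val) /=; rewrite prednK // => eq_mod.
apply/dvdnP; rewrite /dvdn -(modn_dvdm _ p_r) eq_mod modn_dvdm //.
by rewrite modnMr.
Qed.

End ColoredPermutations.

(** * Cycles and colours of the powers of the generators *)

Section GeneratorPowers.

Variables m r p alpha : nat.
Implicit Types x : 'I_m.+1.

Local Notation u := (ugen r m.+1 p alpha).

Lemma ugen_permE i x : i <= m ->
  Gperm (u i) x =
    (if x == 0 :> nat then i else if x <= i then x.-1 else x) :> nat.
Proof. by move=> le_im; rewrite -tgenE. Qed.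

(** [u i] lowers a nonzero coordinate up to [i] by one and sends 0 to [i]: it is a cycle on
    [0 .. i]. *)
Lemma ugenX_perm_sub i k x : k <= x -> x <= i -> i <= m ->
  Gperm (u i ^+ k)%g x = (x - k)%N :> nat.
Proof.
move=> + le_xi le_im; elim: k => [|k IHk] lt_kx; first by rewrite Gperm1 subn0.
rewrite expgS GpermM ugen_permE // IHk ?(ltnW lt_kx) //.
by case: eqP => [|_]; [lia | case: ifP; lia].
Qed.

Lemma ugenX_perm_top i x : x <= i -> i <= m ->
  Gperm (u i ^+ x.+1)%g x = i :> nat.
Proof.
by move=> le_xi le_im; rewrite expgS GpermM ugen_permE // ugenX_perm_sub // subnn.
Qed.

Lemma ugen_period_perm x : Gperm (u x ^+ x.+1)%g x = x.
Proof. by apply: val_inj; rewrite /= ugenX_perm_top // -ltnS. Qed.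

Lemma ugenX_perm_fix k x : Gperm (u x ^+ k)%g x = x -> x.+1 %| k.
Proof.
rewrite {1}(divn_eq k x.+1) addnC mulnC expgD expgM GpermM.
rewrite (GpermX_fix _ (ugen_period_perm x)).
have lt_mod : k %% x.+1 < x.+1 by rewrite ltn_mod.
move/(congr1 val); rewrite /= ugenX_perm_sub // -1?ltnS // /dvdn.
by move: (k %% _) lt_mod => e; lia.
Qed.

Hypothesis m_gt0 : 0 < m.

(** One turn of the cycle collects every colour on [0 .. x]: the 1 at coordinate 0 and, only if [x]
    is [m], also [p - 1] at the last coordinate. *)
Lemma ugen_period_col x :
  Gcol (u x ^+ x.+1)%g x = (Zmod1 r *+ (if x == m :> nat then p else 1%N))%R.
Proof.
have le_xm : x <= m by rewrite -ltnS.
have := GcolX (u x) x x.+1; rewrite ugen_period_perm => ->.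
rewrite big_ord_recr /= ugen_period_perm ffunE /=.
case: (posnP x) => [x0 | x_gt0].
  rewrite big1 => [|[s lt_s] _]; last by lia.
  by rewrite x0 add0r; case: eqP => [|_]; [lia | rewrite mulr1n].
(* The summand of index [x.-1] is the visit to coordinate 0. *)
have lt_px : x.-1 < x by lia.
rewrite (bigD1 (Ordinal lt_px)) //= big1 => [|s]; last first.
  rewrite -val_eqE /= => neq_s; rewrite ffunE ugenX_perm_sub //.
  by have := ltn_ord s; case: eqP => [|_]; [lia | case: eqP; [lia|]].
rewrite ffunE ugenX_perm_sub ?(prednK x_gt0) // subnn /= addr0.
by case: eqP => _; rewrite ?addr0 ?mulr1n // addrC subrK inZp_Zmod1.
Qed.

Lemma ugen_col_last i :
  Gcol (u i) ord_max =
    (Zmod1 r *+ (if i == m then p else alpha * p) - Zmod1 r)%R.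
Proof.
by rewrite ffunE /= eqxx; case: eqP => [|_]; [lia | rewrite -!inZp_Zmod1; case: ifP].
Qed.

Lemma csum_ugen i :
  csum (u i) = (Zmod1 r *+ (if i == m then p else alpha * p))%R.
Proof.
rewrite /csum big_ord_recr /= ugen_col_last.
rewrite (bigD1 (Ordinal m_gt0)) //= big1 => [|s neq_s].
  by rewrite ffunE /= addr0 addrC subrK.
rewrite ffunE /=; case: eqP => [s0|_].
  by rewrite -val_eqE /= s0 in neq_s.
by case: eqP => [|//]; have := ltn_ord s; lia.
Qed.

End GeneratorPowers.

(** * The tower of subgroups below the top generator *)

Section Tower.

Variables m r p alpha : nat.
Hypothesis m_gt0 : 0 < m.
Hypothesis r_gt0 : 0 < r.
Hypothesis p_gt0 : 0 < p.
Hypothesis p_r : p %| r.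
Hypothesis alpha_coprime :
  coprimez (m.+1%:Z - (m * (alpha * p))%:Z)%R (r %/ p)%:Z.
Implicit Types (x : 'I_m.+1) (g h : Grn r m.+1).

Local Notation u := (ugen r m.+1 p alpha).

(** The last condition is the rule for the last colour with the sum of the other colours added to
    both sides. It then involves only [csum] and the last colour, both additive on elements fixing
    the last coordinate. *)
Definition tower (l : nat) : {set Grn r m.+1} :=
  [set g | [&& [forall x : 'I_m.+1, (l <= x) ==> (Gperm g x == x)],
               [forall x : 'I_m.+1, (l <= x < m) ==> (Gcol g x == 0%R)]
             & csum g == ((csum g - Gcol g ord_max) *+ (alpha * p))%R]].

Lemma towerP l g :
  reflect [/\ forall x, l <= x -> Gperm g x = x,
              forall x, l <= x < m -> Gcol g x = 0%R
            & csum g = ((csum g - Gcol g ord_max) *+ (alpha * p))%R]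
          (g \in tower l).
Proof.
rewrite inE; apply: (iffP and3P) => [[/forallP fixg /forallP colg /eqP sumg]|].
  split=> // x lx; apply/eqP; first by have /implyP := fixg x; apply.
  by have /implyP := colg x; apply.
case=> fixg colg sumg; split; last exact/eqP.
  by apply/forallP => x; apply/implyP => lx; rewrite fixg.
by apply/forallP => x; apply/implyP => lx; rewrite colg.
Qed.

Lemma tower_group_set l : l <= m -> group_set (tower l).
Proof.
move=> le_lm; apply/group_setP; split.
  apply/towerP; split=> [x _|x _|]; rewrite ?Gperm1 ?Gcol1 //.
  by rewrite csum1 subrr mul0rn.
move=> g h /towerP[fixg colg sumg] /towerP[fixh colh sumh].
apply/towerP; split=> [x lx|x lx|].
- by rewrite GpermM fixh ?fixg.
- have /andP[lx' _] := lx; rewrite GcolM_fix ?fixg // colg // colh //.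
  by rewrite addr0.
(* [l <= m] ensures that [g] fixes the last coordinate. *)
rewrite csumM GcolM_fix ?fixg // {1}sumg {1}sumh -mulrnDl; congr (_ *+ _)%R.
by rewrite opprD addrACA.
Qed.

Lemma tower_sub l : tower l \subset tower l.+1.
Proof.
apply/subsetP => g /towerP[fixg colg sumg]; apply/towerP; split=> // x.
  by move=> lx; apply/fixg/ltnW.
by case/andP=> lx xm; apply: colg; rewrite (ltnW lx).
Qed.

Lemma tower_pred x g : g \in tower x.+1 ->
  Gperm g x = x -> Gcol g x = 0%R -> g \in tower x.
Proof.
move=> /towerP[fixg colg sumg] gx cgx; apply/towerP; split=> // y.
  rewrite leq_eqVlt => /predU1P[xy|]; last exact: fixg.
  by rewrite (val_inj xy) in gx.
case/andP; rewrite leq_eqVlt => /predU1P[xy _|ltxy ltym].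
  by rewrite (val_inj xy) in cgx.
by rewrite colg // ltxy.
Qed.

Lemma tower0 : tower 0 = 1%g.
Proof.
apply/setP => g; apply/idP/set1P => [/towerP[fixg colg sumg]|]; last first.
  by move->; have /group_setP[] := tower_group_set (leq0n m).
have sum_last : csum g = Gcol g ord_max.
  rewrite /csum big_ord_recr /= big1 ?add0r // => i _; apply: colg => /=.
  exact: ltn_ord.
rewrite sum_last subrr mul0rn in sumg.
apply/Grn_eqP => [x|]; last by apply/permP => x; rewrite fixg // Gperm1.
rewrite Gcol1; have [xm|] := ltnP x m; first exact: colg.
move=> le_mx; rewrite -[RHS]sumg; congr (Gcol g _); apply: val_inj => /=.
by have := ltn_ord x; lia.
Qed.

Lemma ugen_tower i : i < m -> u i \in tower i.+1.
Proof.
move=> lt_im; apply/towerP; split=> [x lx|x /andP[lx xm]|].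
- apply: val_inj; rewrite /= ugen_permE ?(ltnW lt_im) //.
  by case: eqP => [|_]; [lia | case: ifP; lia].
- rewrite ffunE /=; case: eqP => [|_]; first by lia.
  by case: eqP => [|//]; lia.
- by rewrite csum_ugen // ugen_col_last // subKr ltn_eqF.
Qed.

(* The orbit of [x] under [u x] is [0 .. x], so an element of [<[u x]>] that
   fixes [x] fixes the whole orbit and is constantly coloured on it. *)
Lemma cycle_ugen_fix x (y : 'I_m.+1) z : z \in <[u x]>%g -> Gperm z x = x -> y <= x ->
  Gperm z y = y /\ Gcol z y = Gcol z x.
Proof.
case/cycleP=> k -> zx le_yx; have le_xm : x <= m by rewrite -ltnS.
have comm : commute (u x ^+ k)%g (u x ^+ (x - y))%g.
  exact/commuteX2/commute_refl.
have <- : Gperm (u x ^+ (x - y))%g x = y.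
  by apply: val_inj; rewrite /= ugenX_perm_sub ?leq_subr // subKn.
by split; [exact: commute_Gperm_fix | exact: commute_Gcol_fix].
Qed.

(** A common element fixes [x] with colour 0, hence does so on the whole orbit [0 .. x], and thus
    lies in [tower 0]. *)
Lemma tower_TI x : x < m -> (<[u x]> :&: tower x)%g = 1%g.
Proof.
move=> lt_xm; apply/eqP; rewrite eqEsubset; apply/andP; split; last first.
  by rewrite sub1set inE group1; case/group_setP: (tower_group_set (ltnW lt_xm)).
apply/subsetP => z; rewrite inE => /andP[uz zx].
rewrite -tower0; apply/towerP; case/towerP: zx => fixz colz sumz.
have zx : Gperm z x = x by exact: fixz.
split=> // y; case: (leqP x y) => [|lt_yx _]; first by move=> ? _; exact: fixz.
- by case: (cycle_ugen_fix uz zx (ltnW lt_yx)).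
- by move=> le_xy lt_ym; apply: colz; rewrite le_xy.
by case: (cycle_ugen_fix uz zx (ltnW lt_yx)) => _ ->; rewrite colz // leqnn.
Qed.

Lemma ugen_cycle_fix x g : (forall y : 'I_m.+1, x < y -> Gperm g y = y) ->
  exists2 v, v \in <[u x]>%g & Gperm (v * g)%g x = x.
Proof.
(* [g] fixes all points above [x], so [Gperm g x] is at most [x], and this power brings it up to
   [x]. *)
move=> fixg; exists (u x ^+ (Gperm g x).+1)%g; first exact: mem_cycle.
rewrite GpermM; apply: val_inj; rewrite /= ugenX_perm_top // -1?ltnS //.
rewrite ltnNge; apply/negP => lt_xgx.
by have /perm_inj gxx := fixg _ lt_xgx; rewrite gxx ltnn in lt_xgx.
Qed.

Lemma tower_mul x : x < m -> tower x.+1 = (<[u x]> * tower x)%g.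
Proof.
move=> lt_xm; pose T := Group (tower_group_set lt_xm).
have uT : <[u x]>%g \subset T by rewrite cycle_subG; exact: ugen_tower.
apply/eqP; rewrite eqEsubset; apply/andP; split; last first.
  by apply: (@mul_subG _ T); [exact: uT | exact: tower_sub].
apply/subsetP => g gT; have [fixg _ _] := towerP _ _ gT.
have [v uv vgx] := ugen_cycle_fix fixg.
(* [v] has put [x] back in place; each factor [u x ^+ x.+1] keeps it there and adds 1 to its colour,
   so [c] of them cancel that colour. *)
pose c : nat := (- Gcol (v * g)%g x)%R.
pose w := ((u x ^+ x.+1) ^+ c * v)%g.
have uw : w \in <[u x]>%g by rewrite groupM // !groupX // cycle_id.
have wgx : Gperm (w * g)%g x = x.
  by rewrite -mulgA GpermM vgx GpermX_fix // ugen_period_perm.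
apply/mulsgP; exists w^-1%g (w * g)%g; rewrite ?groupV ?mulKg //.
apply: tower_pred => //.
  by apply: (@groupM _ T) => //; apply: (subsetP uT).
rewrite -mulgA GcolM_fix; last by rewrite GpermX_fix // ugen_period_perm.
rewrite GcolX_fix ?ugen_period_perm // ugen_period_col // ltn_eqF // mulr1n.
by rewrite -inZp_Zmod1 valZpK addNr.
Qed.

(** * The factorization of G(r,p,n) by the top generator *)

Let rE : r = (p * (r %/ p))%N.
Proof. by rewrite mulnC divnK. Qed.

Lemma top_TI : (<[u m]> :&: tower m)%g = 1%g.
Proof.
apply/eqP; rewrite eqEsubset; apply/andP; split; last first.
  by rewrite sub1set inE group1; case/group_setP: (tower_group_set (leqnn m)).
apply/subsetP => z; rewrite inE => /andP[uz /towerP[fixz _ sumz]].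
have zm : Gperm z ord_max = ord_max by exact: fixz.
have [q zE] : exists q, z = ((u m ^+ m.+1) ^+ q)%g.
  have /cycleP[k zE] := uz; have /dvdnP[q kE] : m.+1 %| k.
    by apply: (@ugenX_perm_fix _ r p alpha k ord_max); rewrite -zE.
  by exists q; rewrite zE kE mulnC expgM.
have pm : Gperm (u m ^+ m.+1)%g ord_max = ord_max.
  exact: (ugen_period_perm r p alpha ord_max).
have cm : Gcol z ord_max = (Zmod1 r *~ (p * q)%:Z)%R.
  rewrite zE GcolX_fix // (@ugen_period_col _ r p alpha m_gt0 ord_max) eqxx.
  by rewrite -mulrnA -pmulrn.
have sm : csum z = (Zmod1 r *~ (p * m.+1 * q)%:Z)%R.
  by rewrite zE !csumX csum_ugen // eqxx -!mulrnA mulnA -pmulrn.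
have cm0 : Gcol z ord_max = 0%R.
  apply/eqP; rewrite cm Zmod1_intmul_eq0 //.
  (* The tower condition for total [p * m.+1 * q] and last colour [p * q]. Cancelling [p] and the
     coprime coefficient leaves [r %/ p] dividing [q]. *)
  have : (Zmod1 r *~ (p%:Z * (q%:Z * (m.+1%:Z - (m * (alpha * p))%:Z))) == 0)%R.
    move/eqP: sumz; rewrite sm cm -subr_eq0 -mulrzBr pmulrn -mulrzA -mulrzBr.
    by congr (_ *~ _ == _)%R; rewrite !PoszM; ring.
  rewrite Zmod1_intmul_eq0 // {1 2}rE (PoszM p q) (PoszM p (r %/ p)).
  by rewrite !dvdz_mul2l -?lt0n ?Gauss_dvdzl // coprimez_sym.
apply/set1P/Grn_eqP => [x|].
  have [_ ->] := cycle_ugen_fix (x := ord_max) uz zm (y := x) (leq_ord x).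
  by rewrite cm0 Gcol1.
apply/permP => x; rewrite Gperm1.
by case: (cycle_ugen_fix (x := ord_max) uz zm (y := x) (leq_ord x)).
Qed.

Lemma top_mul : Grpn r m.+1 p = (<[u m]> * tower m)%g.
Proof.
pose T := Group (Grpn_group_set m.+1 r_gt0 p_r).
have uT : <[u m]>%g \subset T.
  rewrite cycle_subG; apply/(in_Grpn _ r_gt0 p_r); exists 1.
  by rewrite csum_ugen // eqxx muln1.
apply/eqP; rewrite eqEsubset; apply/andP; split; last first.
  apply: (@mul_subG _ T) => //; apply/subsetP => g /towerP[_ _ sumg].
  apply/(in_Grpn _ r_gt0 p_r); rewrite sumg; set t := (csum g - _)%R.
  exists (alpha * t); rewrite {1}[t]Zmod1_gen -pmulrn -mulrnA.
  by congr (_ *+ _)%R; lia.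
apply/subsetP => g gT.
have [] := @ugen_cycle_fix ord_max g.
  by move=> y /=; rewrite ltnNge -ltnS ltn_ord.
rewrite /= => v uv vgm.
have vgT : (v * g)%g \in T by apply: groupM => //; apply: (subsetP uT).
have [s vgE] := in_Grpn _ r_gt0 p_r vgT.
set t := (csum (v * g)%g - Gcol (v * g)%g ord_max)%R.
pose N : int := (m.+1%:Z - (m * (alpha * p))%:Z)%R.
have [[a b] /= bezout] := coprimezP _ _ alpha_coprime.
(* Multiplying [v * g] by the [q]-th power of [u m ^+ m.+1] turns the tower condition into
   [N * q + W = 0] modulo [r %/ p]. The Bezout coefficient [a] inverts [N], so [q] is [- W * a],
   reduced modulo [r] to a natural number. *)
pose W : int := (s%:Z - (alpha * t)%:Z)%R.
pose q : nat := `|((- (W * a)) %% r%:Z)%Z|%N.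
have [e qE] : exists e : int, (q%:Z = - (W * a) + e * r%:Z)%R.
  exists (- ((- (W * a)) %/ r%:Z)%Z)%R; rewrite /q gez0_abs ?modz_ge0 //; last by lia.
  by rewrite /modz mulNr.
pose w := ((u m ^+ m.+1) ^+ q * v)%g.
have uw : w \in <[u m]>%g by rewrite groupM // !groupX // cycle_id.
have pm : Gperm (u m ^+ m.+1)%g ord_max = ord_max.
  exact: (ugen_period_perm r p alpha ord_max).
have wgm : Gperm (w * g)%g ord_max = ord_max.
  by rewrite -mulgA GpermM vgm GpermX_fix.
apply/mulsgP; exists w^-1%g (w * g)%g; rewrite ?groupV ?mulKg //.
apply/towerP; split=> [x le_mx|x|].
- suff -> : x = ord_max by [].
  by apply: val_inj => /=; have := ltn_ord x; lia.
- by case/andP => ?; rewrite ltnNge => /negP.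
have cm : Gcol (w * g)%g ord_max =
    (Zmod1 r *~ (p * q)%:Z + Gcol (v * g)%g ord_max)%R.
  rewrite -mulgA (GcolM_fix (v * g)%g (GpermX_fix q pm)) (GcolX_fix q pm).
  rewrite (@ugen_period_col _ r p alpha m_gt0 ord_max) eqxx.
  by rewrite -mulrnA -pmulrn.
have sm : csum (w * g)%g = (Zmod1 r *~ (p * m.+1 * q)%:Z + csum (v * g)%g)%R.
  by rewrite -mulgA (csumM _ (v * g)%g) !csumX csum_ugen // eqxx -!mulrnA mulnA -pmulrn.
have -> : (csum (w * g)%g - Gcol (w * g)%g ord_max =
    Zmod1 r *~ ((p * m.+1 * q)%:Z - (p * q)%:Z + (t : nat)%:Z))%R.
  by rewrite sm cm opprD addrACA mulrzDr mulrzBr -Zmod1_gen.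
rewrite sm vgE; apply/eqP.
rewrite pmulrn -subr_eq0 [(_ *+ (alpha * p))%R]pmulrn -mulrzA -mulrzDr -mulrzBr.
rewrite Zmod1_intmul_eq0 //; apply/dvdzP.
exists (W * b + p%:Z * N * e)%R.
have bN : (1 - a * N = b * (r %/ p)%:Z)%R by rewrite -bezout addrAC subrr add0r.
transitivity (p%:Z * (N * q%:Z + W))%R; first by rewrite /N /W !PoszM; ring.
transitivity (p%:Z * (W * (1 - a * N) + N * e * r%:Z))%R; first by rewrite qE; ring.
have rZ : r%:Z%R = (p%:Z * (r %/ p)%:Z)%R by rewrite {1}rE PoszM.
by rewrite bN rZ; ring.
Qed.

(** * Assembly of the chain *)

Lemma tower_perfect_basis : perfect_basis (Grpn r m.+1 p) (useq r m.+1 p alpha).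
Proof.
(* The whole group G(r,p,n) is placed on top of the tower, at index [m.+1]. *)
pose H l := if l <= m then tower l else Grpn r m.+1 p.
have gH l : group_set (H l).
  rewrite /H; case: ifP => [|_]; first exact: tower_group_set.
  exact: Grpn_group_set.
have -> : Grpn r m.+1 p = Group (gH m.+1) :> {set _} by rewrite /= /H ltnn.
apply: (@perfect_basis_chain _ u (fun l => Group (gH l))) => [|i|i] /=;
  rewrite /H; first exact: tower0.
  rewrite ltnS => le_im; rewrite le_im; move: le_im.
  rewrite leq_eqVlt => /predU1P[->|lt_im]; first by rewrite ltnn top_mul.
  by rewrite lt_im (tower_mul (x := Ordinal (leqW lt_im))).
rewrite ltnS => le_im; rewrite le_im; move: le_im.
rewrite leq_eqVlt => /predU1P[->|lt_im]; first exact: top_TI.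
exact: (tower_TI (x := Ordinal (leqW lt_im))).
Qed.

End Tower.

Theorem theorem3p3 (n r p : nat) (hn : 2 <= n) (hr : 1 <= r) (hp : 0 < p)
    (hpr : p %| r) (hgcd : gcdn n (gcdn p (r %/ p)) = 1) :
  exists alpha : nat,
    alpha < r %/ p /\ perfect_basis (Grpn r n p) (useq r n p alpha).
Proof.
case: n hn hgcd => // m m_gt0 gcd1.
have q_gt0 : 0 < r %/ p by rewrite divn_gt0 // dvdn_leq.
have [alpha lt_alpha alpha_coprime] := exists_coprime_shift q_gt0 gcd1.
by exists alpha; split; last exact: tower_perfect_basis.
Qed.
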